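(* Let $\varepsilon>0$, and suppose $p\le\left(\frac{1-\varepsilon}{\sqrt2}\right)^n$. Let $P_p$ be a random $0/1$ polytope, and let $G_p$ be its associated graph. Then, with high probability, $$\Phi(G_p)=\Omega(|V(G_p)|).$$
   Context: For $n\ge 1$ and a probability parameter $0\le p\le 1$, which may vary with $n$, $Q_p^n\subseteq\{0,1\}^n$ is the random subset obtained by including each point of $\{0,1\}^n$ independently with probability $p$. The random $0/1$ polytope is $P_p=\operatorname{conv}(Q_p^n)\subset\mathbb{R}^n$. Its associated graph ($1$-skeleton) $G_p$ is the undirected graph with vertex set $V(G_p)=Q_p^n$ (the vertices of $P_p$) and edge set the set of $1$-faces (one-dimensional faces) of $P_p$: two distinct vertices $x,y$ are adjacent if and only if the segment $[x,y]$ is a $1$-face of $P_p$. A face of a polytope is its intersection with a supporting hyperplane, that is, a hyperplane that meets the polytope and has the polytope contained in one of its closed halfspaces. The edge expansion of a graph $G=(V,E)$ is $$\Phi(G):=\min_{\substack{\varnothing\subset S\subset V\\ |S|\le |V|/2}}\frac{|E(S,V\setminus S)|}{|S|},$$ where the minimum is over nonempty $S$ and $E(S,V\setminus S)$ is the set of edges with one endpoint in $S$ and the other in $V\setminus S$. ''With high probability'' means with probability tending to $1$ as $n\to\infty$, and $\Omega(\cdot)$ denotes a lower bound up to a positive constant factor not depending on $n$. *)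

(* Defs.v *)
From HB Require Import structures.
From mathcomp Require Import all_boot all_order all_algebra.
From mathcomp Require Import all_classical all_reals all_analysis.

Set Implicit Arguments.
Unset Strict Implicit.
Unset Printing Implicit Defensive.

Import Order.TTheory GRing.Theory Num.Theory.
Import numFieldNormedType.Exports.

Local Open Scope classical_set_scope.
Local Open Scope convex_scope.
Local Open Scope ring_scope.

Definition cube (n : nat) := {ffun 'I_n -> bool}.

Definition cube_point (R : realType) (n : nat) (x : cube n) : 'rV[R]_n :=
  \row_i (x i)%:R.

Arguments cube_point R {n} x.

Definition convex_hull (R : realType) (n : nat) (X : set 'rV[R]_n) :
    set 'rV[R]_n :=
  smallest (@convex_set R 'rV[R]_n) X.

Definition polytope01 (R : realType) (n : nat) (Q : {set cube n}) :
    set 'rV[R]_n :=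
  convex_hull [set cube_point R x | x in [set` Q]].

Arguments polytope01 R {n} Q.

Definition dotp (R : realType) (n : nat) (a z : 'rV[R]_n) : R :=
  \sum_i a 0 i * z 0 i.

Definition hyperplane (R : realType) (n : nat) (a : 'rV[R]_n) (b : R) :
    set 'rV[R]_n :=
  [set z | dotp a z = b].

(* Considering only the halfspace [dotp a z <= b] loses nothing, since
   [(- a, - b)] describes the same hyperplane with the halfspaces exchanged. *)
Definition is_face (R : realType) (n : nat) (P F : set 'rV[R]_n) : Prop :=
  exists a : 'rV[R]_n, exists b : R,
    [/\ a != 0,
        P `&` hyperplane a b !=set0,
        P `<=` [set z | dotp a z <= b] &
        F = P `&` hyperplane a b].

Definition segment (R : realType) (n : nat) (x y : 'rV[R]_n) :
    set 'rV[R]_n :=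
  range (fun t : {i01 R} => (x : convex_lmodType 'rV[R]_n) <| t |> y).

(* The segment between two distinct points is one-dimensional, so it is a
   1-face as soon as it is a face. *)
Definition skeleton_adj (R : realType) (n : nat) (Q : {set cube n}) :
    rel (cube n) :=
  fun x y =>
    [&& x \in Q, y \in Q, x != y &
        `[< is_face (polytope01 R Q)
              (segment (cube_point R x) (cube_point R y)) >]].

Arguments skeleton_adj R {n} Q x y.

Section edge_expansion.
Local Open Scope set_scope.

Definition edge_boundary (T : finType) (V : {set T}) (e : rel T)
    (S : {set T}) : {set {set T}} :=
  [set [set x; y] | x in S, y in V :\: S & e x y].

(* The minimum is taken in [\bar R]; it is [+oo] when no [S] is admissible,
   that is, when the graph has at most one vertex. *)
Definition edge_expansion (R : realType) (T : finType) (V : {set T})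
    (e : rel T) : \bar R :=
  \big[Order.min/+oo%E]_(S : {set T} |
      [&& finset.set0 \proper S, S \proper V & (#|S|.*2 <= #|V|)%N])
    (#|edge_boundary V e S|%:R / #|S|%:R)%:E.

End edge_expansion.

Arguments edge_expansion R {T} V e.

(* Probability that the random subset of [T] containing each point
   independently with probability [p] satisfies [A]. *)
Definition random_subset_prob (R : realType) (T : finType) (p : R)
    (A : {set T} -> Prop) : R :=
  \sum_(Q : {set T} | `[< A Q >]) \prod_(x : T) bernoulli_pmf p (x \in Q).

(* Main.v *)
Require Import Defs.
From HB Require Import structures.
From mathcomp Require Import all_boot all_order all_algebra.
From mathcomp Require Import all_classical all_reals all_analysis.
From mathcomp Require Import zify ring lra.
From mathcomp Require unstable.

(** Write [N = 2 ^+ n * p] for the expected number of points. Two points [x]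
    and [y] of [Q] span an edge as soon as they are not antipodal and [Q] has no
    third point in the smallest face of the cube containing both
    ([skeleton_adj_of_between]). This face has [2 ^+ d] vertices, with [d] the
    Hamming distance; typically [d] is about [n / 2], and the hypothesis on [p]
    makes the expected number of third points exponentially small. So every
    vertex should have few non-neighbours, say at most [#|Q| / 8], and then any
    [S] with at most half of the vertices sends at least [3 / 8 * #|Q|] edges
    out of each of its points ([edge_expansion_ge]).

    A non-neighbour [y] of [x] is either far, at distance at least
    [(1 / 2 + delta) * n], or blocked, that is near and with a third point [z]
    of [Q] in the face. Far points are an exponentially small proportion of the
    cube ([card_far]).

    If [N] is at most a small exponential, the expected numbers of far pairs
    and of blocked triples tend to [0], so that the graph is complete
    ([sparse_prob]).

    If [N] is larger, large deviation bounds are used, strong enough for a union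
    bound over all [2 ^+ n] centres [x] ([dense_prob]). The far points are
    handled by a Chernoff bound. For the blocked points, one first needs that no
    two points of [Q] are close to each other: a point [z] close to [x] would
    block a large part of the cube. The points [z] that are not close to [x]
    have a small shadow (the set of points they block), so a weighted Chernoff
    bound shows that the shadows of all points of [Q] cover an exponentially
    small part of the cube. It remains to see that [Q] has few points in this
    part, which itself depends on [Q]. If [z] blocks [y], some coordinate
    separates [y] from both [x] and [z]; for each of the [n] coordinates, the
    points on the side of [x] determine the blocked region, and the points on
    the other side are independent of it ([decoupled_chernoff]). *)

Set Implicit Arguments.
Unset Strict Implicit.
Unset Printing Implicit Defensive.

Import Order.TTheory GRing.Theory Num.Theory.
Import numFieldNormedType.Exports.

Local Open Scope ring_scope.

(** * Random subsets of a finite type *)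

Definition random_subset_mean (R : realType) (T : finType) (p : R)
    (F : {set T} -> R) : R :=
  \sum_(Q : {set T}) (\prod_(x : T) bernoulli_pmf p (x \in Q)) * F Q.

Lemma random_subset_weight_ge0 (R : realType) (T : finType) (p : R)
    (Q : {set T}) :
  0 <= p <= 1 -> 0 <= \prod_(x : T) bernoulli_pmf p (x \in Q).
Proof. by move=> p01; apply: prodr_ge0 => x _; exact: bernoulli_pmf_ge0. Qed.

Lemma random_subset_probE (R : realType) (T : finType) (p : R)
    (A : {set T} -> Prop) :
  random_subset_prob p A = random_subset_mean p (fun Q => (`[< A Q >])%:R).
Proof.
rewrite /random_subset_prob /random_subset_mean big_mkcond.
by apply: eq_bigr => Q _; case: ifP; rewrite ?mulr1 ?mulr0.
Qed.

Lemma random_subset_mean_le (R : realType) (T : finType) (p : R)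
    (F G : {set T} -> R) :
  0 <= p <= 1 -> (forall Q, F Q <= G Q) ->
  random_subset_mean p F <= random_subset_mean p G.
Proof.
move=> p01 FG; apply: ler_sum => Q _.
by rewrite ler_wpM2l// random_subset_weight_ge0.
Qed.

(** Independence of the points: this is the distributivity of products over
    sums. *)
Lemma random_subset_mean_prod (R : realType) (T : finType) (p : R)
    (h : T -> bool -> R) :
  random_subset_mean p (fun Q => \prod_x h x (x \in Q)) =
  \prod_x (p * h x true + (1 - p) * h x false).
Proof.
rewrite bigA_distr; apply: eq_big => // Q _.
rewrite -big_split /=; apply: eq_bigr => x _.
by rewrite /bernoulli_pmf; case: (x \in Q).
Qed.

Lemma random_subset_mean_cst (R : realType) (T : finType) (p c : R) :
  random_subset_mean p (fun _ : {set T} => c) = c.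
Proof.
rewrite /random_subset_mean -mulr_suml; set W := (X in X * _).
suff -> : W = 1 by rewrite mul1r.
have := @random_subset_mean_prod R T p (fun _ _ => 1).
rewrite [RHS]big1 => [|x _]; last by rewrite !mulr1 addrC subrK.
by move=> <-; apply: eq_bigr => Q _; rewrite [X in _ * X]big1 ?mulr1.
Qed.

Lemma random_subset_mean_mulr (R : realType) (T : finType) (p c : R)
    (F : {set T} -> R) :
  random_subset_mean p (fun Q => F Q * c) = random_subset_mean p F * c.
Proof. by rewrite mulr_suml; apply: eq_bigr => Q _; rewrite mulrA. Qed.

Lemma random_subset_mean_sum (R : realType) (T I : finType) (p : R)
    (P : pred I) (F : I -> {set T} -> R) :
  random_subset_mean p (fun Q => \sum_(i | P i) F i Q) =
  \sum_(i | P i) random_subset_mean p (F i).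
Proof.
by rewrite exchange_big; apply: eq_bigr => Q _; rewrite mulr_sumr.
Qed.

Lemma random_subset_prob_mono (R : realType) (T : finType) (p : R)
    (A B : {set T} -> Prop) :
  0 <= p <= 1 -> (forall Q, A Q -> B Q) ->
  random_subset_prob p A <= random_subset_prob p B.
Proof.
move=> p01 AB; rewrite !random_subset_probE; apply: random_subset_mean_le => //.
by move=> Q; case: (asboolP (A Q)) => [/AB/asboolT -> //|_]; rewrite ler0n.
Qed.

Lemma random_subset_prob_markov (R : realType) (T : finType) (p : R)
    (A : {set T} -> Prop) (F : {set T} -> R) :
  0 <= p <= 1 -> (forall Q, 0 <= F Q) -> (forall Q, A Q -> 1 <= F Q) ->
  random_subset_prob p A <= random_subset_mean p F.
Proof.
move=> p01 F0 F1; rewrite random_subset_probE; apply: random_subset_mean_le => //.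
by move=> Q; case: asboolP => [/F1//|_]; exact: F0.
Qed.

Lemma random_subset_prob_not (R : realType) (T : finType) (p : R)
    (A : {set T} -> Prop) :
  random_subset_prob p A = 1 - random_subset_prob p (fun Q => ~ A Q).
Proof.
apply/eqP; rewrite eq_sym subr_eq eq_sym !random_subset_probE; apply/eqP.
rewrite -[RHS](@random_subset_mean_cst R T p) /random_subset_mean -big_split /=.
apply: eq_bigr => Q _; rewrite -mulrDr asbool_neg.
by case: `[< _ >]; rewrite ?addr0 ?add0r.
Qed.

Lemma random_subset_prob_ge0 (R : realType) (T : finType) (p : R)
    (A : {set T} -> Prop) : 0 <= p <= 1 -> 0 <= random_subset_prob p A.
Proof.
by move=> p01; apply: sumr_ge0 => Q _; exact: random_subset_weight_ge0.
Qed.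

Lemma random_subset_prob_le1 (R : realType) (T : finType) (p : R)
    (A : {set T} -> Prop) : 0 <= p <= 1 -> random_subset_prob p A <= 1.
Proof.
move=> p01; rewrite random_subset_prob_not lerBlDr lerDl.
exact: random_subset_prob_ge0.
Qed.

Lemma random_subset_prob_or (R : realType) (T : finType) (p : R)
    (A B : {set T} -> Prop) : 0 <= p <= 1 ->
  random_subset_prob p (fun Q => A Q \/ B Q) <=
  random_subset_prob p A + random_subset_prob p B.
Proof.
move=> p01; rewrite !random_subset_probE /random_subset_mean -big_split /=.
apply: ler_sum => Q _; rewrite -mulrDr ler_wpM2l ?random_subset_weight_ge0//.
by rewrite asbool_or; do 2 case: `[< _ >]; rewrite /= ?addr0 ?add0r ?lerDl.
Qed.

Lemma random_subset_prob_ex (R : realType) (T I : finType) (p : R)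
    (P : pred I) (A : I -> {set T} -> Prop) : 0 <= p <= 1 ->
  random_subset_prob p (fun Q => exists2 i, P i & A i Q) <=
  \sum_(i | P i) random_subset_prob p (A i).
Proof.
move=> p01; under eq_bigr do rewrite random_subset_probE.
rewrite -random_subset_mean_sum; apply: random_subset_prob_markov => // Q.
  by apply: sumr_ge0 => i _; rewrite ler0n.
case=> i Pi /asboolT AQ; rewrite (bigD1 i)//= AQ lerDl.
by apply: sumr_ge0 => j _; rewrite ler0n.
Qed.

Lemma random_subset_prob_sub (R : realType) (T : finType) (p : R) (S : {set T}) :
  random_subset_prob p (fun Q => S \subset Q) = p ^+ #|S|.
Proof.
rewrite random_subset_probE -prodr_const.
rewrite [RHS]big_mkcond /=.
transitivity (random_subset_mean p
  (fun Q : {set T} => \prod_x (if x \in S then (x \in Q)%:R else 1))).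
  apply: eq_bigr => Q _; congr (_ * _); rewrite asboolb.
  rewrite -big_mkcond /=; case: (boolP (S \subset Q)).
    move=> /fintype.subsetP SQ.
    by rewrite big1// => x /SQ ->.
  by case/fintype.subsetPn => x xS /negbTE xQ; rewrite (bigD1 x)//= xQ mul0r.
rewrite (random_subset_mean_prod p (fun x b => if x \in S then b%:R else 1)).
by apply: eq_bigr => x _; case: ifP; rewrite !mulr1 ?mulr0 ?addr0// addrC subrK.
Qed.

(** Exponential moment of a linear statistic; it follows from independence and
    [1 + u <= expR u]. *)
Lemma random_subset_mgf (R : realType) (T : finType) (p : R) (g : T -> R) :
  0 <= p <= 1 ->
  random_subset_mean p (fun Q => expR (\sum_(x in Q) g x)) <=
  expR (p * \sum_x (expR (g x) - 1)).
Proof.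
move=> p01.
have -> : random_subset_mean p (fun Q => expR (\sum_(x in Q) g x)) =
    random_subset_mean p
      (fun Q : {set T} => \prod_x (if x \in Q then expR (g x) else 1)).
  by apply: eq_bigr => Q _; rewrite -big_mkcond /= expR_sum.
rewrite (random_subset_mean_prod p (fun x b => if b then expR (g x) else 1)) /=.
rewrite mulr_sumr expR_sum; apply: ler_prod => x _; apply/andP; split.
  case/andP: p01 => p0 p1.
  by rewrite addr_ge0// mulr_ge0// ?expR_ge0// subr_ge0.
by apply: le_trans (expR_ge1Dx _); rewrite mulr1 mulrBr mulr1; lra.
Qed.

(** [expR v <= 1 / (1 - v) <= 1 + 2 * v] for [0 <= v <= 1 / 2]; the second
    inequality is the reason for halving [u]. *)
Lemma expR_half_le (R : realType) (u : R) :
  0 <= u <= 1 -> expR (u / 2) - 1 <= u.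
Proof.
case/andP=> u0 u1; have := expR_ge1Dx (- (u / 2)).
rewrite expRN => h; have e0 := expR_gt0 (u / 2).
have : (1 - u / 2) * expR (u / 2) <= 1 by rewrite -ler_pdivlMr// mul1r.
nra.
Qed.

Lemma chernoff_upper (R : realType) (T : finType) (p t : R) (f : T -> R) :
  0 <= p <= 1 -> (forall x, 0 <= f x <= 1) ->
  random_subset_prob p (fun Q => t <= \sum_(x in Q) f x) <=
  expR (p * \sum_x f x - t / 2).
Proof.
move=> p01 f01; rewrite expRD.
apply: (@le_trans _ _ (random_subset_mean p
  (fun Q => expR (\sum_(x in Q) (f x / 2)) * expR (- (t / 2))))).
  apply: random_subset_prob_markov => // Q tQ.
  rewrite -expRD -[leLHS]expR0 ler_expR -mulr_suml -mulrBl.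
  by rewrite divr_ge0// subr_ge0.
rewrite random_subset_mean_mulr ler_wpM2r ?expR_ge0//.
apply: le_trans (random_subset_mgf _ p01) _; rewrite ler_expR.
case/andP: p01 => p0 _; rewrite ler_wpM2l//; apply: ler_sum => x _.
exact: expR_half_le.
Qed.

Lemma sum_indicator (R : realType) (T : finType) (P : pred T) (A : {set T}) :
  \sum_(x | P x) (x \in A)%:R = #|[set x in A | P x]|%:R :> R.
Proof.
rewrite -natr_sum -sum1_card; congr (_%:R).
rewrite [RHS](eq_bigl (fun x => P x && (x \in A))) => [|x].
  by rewrite big_mkcondr; apply: eq_bigr => x _; case: (x \in A).
by rewrite inE andbC.
Qed.

Lemma chernoff_card_upper (R : realType) (T : finType) (p t : R) (A : {set T}) :
  0 <= p <= 1 ->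
  random_subset_prob p (fun Q => t <= #|Q :&: A|%:R) <=
  expR (p * #|A|%:R - t / 2).
Proof.
move=> p01.
have := @chernoff_upper R T p t (fun x => (x \in A)%:R) p01.
rewrite sum_indicator (_ : finset _ = A); last first.
  by apply/finset.setP => x; rewrite inE andbT.
move=> h; apply: le_trans (h _); last by move=> x; rewrite ler0n lern1 leq_b1.
apply: random_subset_prob_mono => // Q.
rewrite sum_indicator (_ : finset _ = Q :&: A)//.
by apply/finset.setP => x; rewrite !inE andbC.
Qed.

(** The exponential moment is taken at parameter [-1], where
    [expR (-1) - 1 <= - 1 / 2]. *)
Lemma chernoff_card_lower (R : realType) (T : finType) (p : R) :
  0 <= p <= 1 ->
  random_subset_prob p (fun Q : {set T} => #|Q|%:R <= p * #|T|%:R / 4) <=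
  expR (- (p * #|T|%:R / 4)).
Proof.
move=> p01; set t := p * _ / 4.
apply: (@le_trans _ _ (random_subset_mean p
  (fun Q : {set T} => expR (\sum_(x in Q) (-1)) * expR t))).
  apply: random_subset_prob_markov => // Q tQ.
  rewrite -expRD -[leLHS]expR0 ler_expR sumr_const mulNrn addrC subr_ge0.
  exact: tQ.
rewrite random_subset_mean_mulr -ler_pdivlMr ?expR_gt0// -expRN -expRD.
apply: le_trans (random_subset_mgf _ p01) _; rewrite ler_expR sumr_const.
have e2 : expR (-1) <= 2^-1 :> R.
  rewrite expRN lef_pV2 ?posrE ?expR_gt0//.
  by have := expR_ge1Dx (1 : R); lra.
case/andP: p01 => p0 _; rewrite -[X in p * X]mulr_natl mulrA.
have -> : - t - t = p * #|T|%:R * - 2^-1 by rewrite /t; lra.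
by apply: ler_wpM2l; [exact: mulr_ge0|lra].
Qed.

(** The traces of the random set on a set [A] and on its complement are
    independent, so that the second one may be taken from a fresh copy. The two
    random sets are exchanged outside [A], an involution that preserves
    their joint weight. *)
Lemma random_subset_mean_split (R : realType) (T : finType) (p : R)
    (A : {set T}) (F : {set T} -> {set T} -> R) :
  random_subset_mean p (fun Q => F (Q :&: A) (Q :\: A)) =
  random_subset_mean p (fun Q =>
    random_subset_mean p (fun Q' => F (Q :&: A) (Q' :\: A))).
Proof.
pose w (Q : {set T}) : R := \prod_x bernoulli_pmf p (x \in Q).
pose mix (Q Q' : {set T}) := (Q :&: A) :|: (Q' :\: A).
have mixI Q Q' : mix Q Q' :&: A = Q :&: A.
  apply/finset.setP=> x; rewrite !inE.
  by case: (x \in A); rewrite ?andbT ?andbF ?orbF.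
have mixD Q Q' : mix Q Q' :\: A = Q' :\: A.
  apply/finset.setP=> x; rewrite !inE.
  by case: (x \in A); rewrite ?andbT ?andbF ?orbF.
have mixw Q Q' : w (mix Q Q') * w (mix Q' Q) = w Q * w Q'.
  rewrite -!big_split; apply: eq_bigr => x _; rewrite !inE.
  by case: (x \in A); rewrite ?andbT ?andbF ?orbF//= mulrC.
pose sw (u : {set T} * {set T}) := (mix u.1 u.2, mix u.2 u.1).
have mixK Q Q' : mix (mix Q Q') (mix Q' Q) = Q.
  by rewrite {1}/mix mixI mixD finset.setID.
have swK : involutive sw by case=> Q Q'; rewrite /sw /= !mixK.
pose G (u : {set T} * {set T}) := w u.1 * w u.2 * F (u.1 :&: A) (u.1 :\: A).
transitivity (\sum_u G u).
  rewrite -(pair_bigA _ (fun Q Q' => w Q * w Q' * F (Q :&: A) (Q :\: A))) /=.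
  apply: eq_bigr => Q _; rewrite -mulr_suml -mulr_sumr -/(w Q).
  congr (_ * _); rewrite -[LHS]mulr1; congr (_ * _).
  rewrite -(@random_subset_mean_cst R T p 1).
  by apply: eq_bigr => Q' _; rewrite mulr1.
rewrite (reindex_inj (inv_inj swK)).
have -> : \sum_u G (sw u) = \sum_u w u.1 * w u.2 * F (u.1 :&: A) (u.2 :\: A).
  by apply: eq_bigr => -[Q Q'] _; rewrite /G /= mixI mixD mixw.
rewrite -(pair_bigA _ (fun Q Q' => w Q * w Q' * F (Q :&: A) (Q' :\: A))) /=.
apply: eq_bigr => Q _; rewrite /random_subset_mean mulr_sumr.
by apply: eq_bigr => Q' _; rewrite mulrA.
Qed.

(** Conditionally on the trace on [A], the set [U] is fixed and the rest of the
    random set is still fresh. *)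
Lemma decoupled_chernoff (R : realType) (T : finType) (p t u : R)
    (A : {set T}) (U : {set T} -> {set T}) :
  0 <= p <= 1 ->
  random_subset_prob p (fun Q =>
    #|U (Q :&: A)|%:R <= u /\ t <= #|(Q :\: A) :&: U (Q :&: A)|%:R) <=
  expR (p * u - t / 2).
Proof.
move=> p01; rewrite random_subset_probE.
rewrite (random_subset_mean_split p A (fun Z Y =>
  (`[< #|U Z|%:R <= u /\ t <= #|Y :&: U Z|%:R >])%:R)).
rewrite -[leRHS](@random_subset_mean_cst R T p).
apply: random_subset_mean_le => // Q.
have [Uu|Uu] := leP #|U (Q :&: A)|%:R u; last first.
  rewrite (_ : random_subset_mean _ _ = 0) ?expR_ge0//.
  by rewrite /random_subset_mean big1// => Q' _; rewrite asboolF ?mulr0// => -[].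
apply: le_trans (_ : expR (p * #|U (Q :&: A)|%:R - t / 2) <= _); last first.
  by rewrite ler_expR lerD2r ler_wpM2l//; case/andP: p01.
apply: le_trans (chernoff_card_upper t _ p01).
rewrite random_subset_probE; apply: random_subset_mean_le => // Q'.
rewrite ler_nat; case: asboolP => //= -[_ ht]; rewrite asboolT//.
apply: le_trans ht _; rewrite ler_nat subset_leq_card//.
by rewrite finset.setSI// finset.subsetDl.
Qed.

(** * A sufficient condition for adjacency in a 0/1 polytope *)

Definition hamming n (x y : cube n) : nat := #|[set i | x i != y i]|.

(** The vertices of the smallest face of the cube containing [x] and [y]. *)
Definition between n (x y z : cube n) : bool :=
  [forall i, (z i == x i) || (z i == y i)].

Lemma dotpD (R : realType) n (a u v : 'rV[R]_n) :
  dotp a (u + v) = dotp a u + dotp a v.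
Proof. by rewrite -big_split; apply: eq_bigr => i _; rewrite mxE mulrDr. Qed.

Lemma dotpZ (R : realType) n (a : 'rV[R]_n) (t : R) (v : 'rV[R]_n) :
  dotp a (t *: v) = t * dotp a v.
Proof. by rewrite mulr_sumr; apply: eq_bigr => i _; rewrite mxE mulrCA. Qed.

Lemma segmentP (R : realType) n (u v w : 'rV[R]_n) :
  segment u v w <-> exists2 t : R, 0 <= t <= 1 & w = t *: u + (1 - t) *: v.
Proof.
split=> [[t _ <-]|[t /andP[t0 t1] ->]].
  by exists t%:num; rewrite ?ge0 ?le1.
by exists (Itv01 t0 t1).
Qed.

Lemma segment_convex (R : realType) n (u v w1 w2 : 'rV[R]_n) (s : R) :
  0 <= s <= 1 -> segment u v w1 -> segment u v w2 ->
  segment u v (s *: w1 + (1 - s) *: w2).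
Proof.
move=> s01 /segmentP[t1 t101 ->] /segmentP[t2 t201 ->]; apply/segmentP.
exists (s * t1 + (1 - s) * t2); first by nra.
by apply/rowP => i; rewrite !mxE; ring.
Qed.

Lemma polytope01_convex (R : realType) n (Q : {set cube n})
    (u v : 'rV[R]_n) (t : R) :
  0 <= t <= 1 -> polytope01 R Q u -> polytope01 R Q v ->
  polytope01 R Q (t *: u + (1 - t) *: v).
Proof.
move=> /andP[t0 t1] Pu Pv C [cC QC].
have := cC u v (Itv01 t0 t1); rewrite !inE; apply.
  exact: Pu.
exact: Pv.
Qed.

Lemma polytope01_point (R : realType) n (Q : {set cube n}) x :
  x \in Q -> polytope01 R Q (cube_point R x).
Proof. by move=> xQ C [_]; apply; exists x. Qed.

(** The points [w] satisfying the conclusion form a convex set: a proper convex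
    combination attains the bound [b] only if both of its points do. *)
Lemma polytope01_face_sub (R : realType) n (Q : {set cube n})
    (a : 'rV[R]_n) (b : R) (u v : 'rV[R]_n) :
  (forall z, z \in Q -> dotp a (cube_point R z) <= b) ->
  (forall z, z \in Q -> dotp a (cube_point R z) = b ->
     segment u v (cube_point R z)) ->
  forall w, polytope01 R Q w ->
    dotp a w <= b /\ (dotp a w = b -> segment u v w).
Proof.
move=> le_b seg_b w Pw.
apply: (Pw (fun w => dotp a w <= b /\ (dotp a w = b -> segment u v w))).
split=> [w1 w2 t|_ [z zQ <-]]; last by split; [exact: le_b|exact: seg_b].
rewrite !inE => -[le1 seg1] [le2 seg2].
set w' := conv _ _ _; have {w'}-> : w' = t%:num *: w1 + (1 - t%:num) *: w2 by [].
have t0 : 0 <= t%:num by []. have t1 : t%:num <= 1 by [].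
rewrite dotpD !dotpZ; split; first by nra.
move=> eq_b; have [t_0|t_neq0] := eqVneq t%:num 0.
  rewrite t_0 scale0r add0r subr0 scale1r; apply: seg2.
  by rewrite t_0 in eq_b; lra.
have [t_1|t_neq1] := eqVneq t%:num 1.
  rewrite t_1 subrr scale0r addr0 scale1r; apply: seg1.
  by rewrite t_1 in eq_b; lra.
have tp : 0 < t%:num by rewrite lt_neqAle eq_sym t_neq0.
have tl : t%:num < 1 by rewrite lt_neqAle t_neq1.
apply: segment_convex; first by rewrite t0 t1.
  by apply: seg1; nra.
by apply: seg2; nra.
Qed.

(** The form that counts, with sign, the coordinates where [x] and [y] agree;
    on the cube it is maximal exactly on the smallest face through [x] and [y].
    It is nonzero because [x] and [y] are not antipodal. *)
Lemma skeleton_adj_of_between (R : realType) n (Q : {set cube n}) x y :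
  x \in Q -> y \in Q -> x != y -> (hamming x y < n)%N ->
  (forall z, z \in Q -> between x y z -> z = x \/ z = y) ->
  skeleton_adj R Q x y.
Proof.
move=> xQ yQ xy dxy only; rewrite /skeleton_adj xQ yQ xy /=; apply/asboolP.
pose a : 'rV[R]_n := \row_i (if x i == y i then (-1) ^+ (~~ x i) else 0).
pose b := dotp a (cube_point R x).
have defect z : b - dotp a (cube_point R z) =
    \sum_i ((x i == y i) && (z i != x i))%:R.
  rewrite -sumrB; apply: eq_bigr => i _; rewrite !mxE.
  by case: (x i); case: (y i); case: (z i); rewrite /= ?expr0 ?expr1; ring.
have le_b z : dotp a (cube_point R z) <= b.
  by rewrite -subr_ge0 defect sumr_ge0// => i _; rewrite ler0n.
have eq_b z : dotp a (cube_point R z) = b -> between x y z.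
  move/eqP; rewrite eq_sym -subr_eq0 defect psumr_eq0 => [/allP zi|i _];
    last by rewrite ler0n.
  apply/forallP => i; have := zi i (mem_index_enum i); rewrite pnatr_eq0 eqb0.
  by case: (x i); case: (y i); case: (z i).
have b_y : dotp a (cube_point R y) = b.
  apply/eqP; rewrite eq_sym -subr_eq0 defect big1// => i _.
  by rewrite eq_sym andbN.
have seg_x : segment (cube_point R x) (cube_point R y) (cube_point R x).
  apply/segmentP; exists 1; first by rewrite ler01 lexx.
  by rewrite subrr scale0r addr0 scale1r.
have seg_y : segment (cube_point R x) (cube_point R y) (cube_point R y).
  apply/segmentP; exists 0; first by rewrite ler01 lexx.
  by rewrite subr0 scale0r add0r scale1r.
have face := @polytope01_face_sub R n Q a b (cube_point R x) (cube_point R y)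
  (fun z _ => le_b z).
have {}face w : polytope01 R Q w -> dotp a w <= b /\
    (dotp a w = b -> segment (cube_point R x) (cube_point R y) w).
  by apply: face => z zQ /eq_b /(only z zQ)[->|->].
exists a, b; split.
- apply/eqP => a0.
  suff : (n <= hamming x y)%N by rewrite leqNgt dxy.
  rewrite /hamming -[leqLHS]card_ord -cardsT subset_leq_card//.
  apply/fintype.subsetP => i _; rewrite inE; apply/negP => xyi.
  move/rowP: a0 => /(_ i); rewrite !mxE xyi => /eqP.
  by rewrite signr_eq0.
- by exists (cube_point R x); split; [exact: polytope01_point|].
- by move=> w /face[].
- apply/seteqP; split=> [w|w [/face[_ fw] hw]]; last exact: fw.
  move=> /segmentP[t t01 ->]; split.
    by apply: polytope01_convex => //; exact: polytope01_point.
  by rewrite /hyperplane /= dotpD !dotpZ b_y -/b; ring.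
Qed.

(** * Expansion of nearly complete graphs *)

Lemma card_edge_boundary_ge (T : finType) (V S : {set T}) (e : rel T) :
  (\sum_(x in S) #|[set y in V :\: S | e x y]| <= #|edge_boundary V e S|)%N.
Proof.
pose D := [set u : T * T | (u.1 \in S) && (u.2 \in [set y in V :\: S | e u.1 y])].
have -> : (\sum_(x in S) #|[set y in V :\: S | e x y]| = #|D|)%N.
  rewrite -sum1_card; under eq_bigr do rewrite -sum1_card.
  rewrite pair_big_dep /=; apply: eq_bigl => -[x y] /=.
  by rewrite [RHS]inE.
pose f (u : T * T) := [set u.1; u.2].
rewrite -(@card_in_imset _ _ f D); last first.
  move=> [x y] [x' y'] /=; rewrite !inE /= => /andP[xS /andP[/andP[yS _] _]].
  move=> /andP[x'S /andP[/andP[y'S _] _]].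
  rewrite /f /= => E.
  have : x \in [set x'; y'] by rewrite -E !inE eqxx.
  have : y \in [set x'; y'] by rewrite -E !inE eqxx orbT.
  rewrite !inE => /orP[/eqP yx'|/eqP <-]; first by rewrite yx' x'S in yS.
  by case/orP=> /eqP xE; rewrite xE// in xS *; rewrite xS in yS.
apply/subset_leq_card/fintype.subsetP => _ /imsetP[[x y] + ->].
rewrite inE => /andP[xS yS]; rewrite /edge_boundary; apply/imset2P.
by exists x y.
Qed.

(** Every vertex of [S] keeps at least [|V| - |S| - |V| / 8] neighbours outside
    [S], which is at least [3 |V| / 8]. *)
Lemma edge_expansion_ge (R : realType) (T : finType) (V : {set T}) (e : rel T) :
  (forall x, x \in V ->
     (8 * #|[set y in V | (y != x) && ~~ e x y]| <= #|V|)%N) ->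
  ((4^-1 * #|V|%:R)%:E <= edge_expansion R V e)%E.
Proof.
move=> few; rewrite /edge_expansion; apply: (big_ind (fun z => (_ <= z)%E)).
- exact: leey.
- by move=> z1 z2 h1 h2; rewrite le_min h1.
move=> S /and3P[S0 /proper_sub SV halfS]; rewrite lee_fin.
have Sp : (0 < #|S|)%N by rewrite (leq_trans _ (proper_card S0))// cards0.
rewrite ler_pdivlMr ?ltr0n//.
have deg x : x \in S -> (#|V| <= 4 * #|[set y in V :\: S | e x y]|)%N.
  move=> xS; have xV := fintype.subsetP SV x xS.
  have sub : V :\: S \subset [set y in V :\: S | e x y] :|:
      [set y in V | (y != x) && ~~ e x y].
    apply/fintype.subsetP => y; rewrite !inE => /andP[yS yV]; rewrite yS yV /=.
    by case: (e x y) => //=; rewrite andbT; apply: contraNneq yS => ->.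
  have := leq_trans (subset_leq_card sub) (leq_card_setU _ _).
  have := few x xV; have := cardsD V S.
  rewrite (finset.setIidPr SV) => -> ; have := subset_leq_card SV.
  move: halfS; rewrite -muln2.
  move: #|V| #|S| #|[set y in V :\: S | e x y]| #|[set y in V | _]| => a b c d.
  lia.
suff : (#|V| * #|S| <= 4 * #|edge_boundary V e S|)%N.
  by rewrite -(ler_nat R) !natrM => h; lra.
apply: leq_trans (_ : 4 * (\sum_(x in S) #|[set y in V :\: S | e x y]|) <= _)%N.
  rewrite big_distrr /= mulnC -sum_nat_const; apply: leq_sum => x xS.
  exact: deg.
by rewrite leq_mul2l card_edge_boundary_ge.
Qed.

(** * Counting points of the cube *)

Lemma sum_cube_prod (R : comNzSemiRingType) n (F : 'I_n -> bool -> R) :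
  \sum_(y : cube n) \prod_i F i (y i) = \prod_i (F i true + F i false).
Proof.
by rewrite -bigA_distr_bigA; apply: eq_bigr => i _; rewrite big_bool.
Qed.

Lemma hamming_le n (x y : cube n) : (hamming x y <= n)%N.
Proof. by rewrite -[leqRHS]card_ord max_card. Qed.

Lemma prod_hamming (R : comNzSemiRingType) n (x y : cube n) (a b : R) :
  \prod_i (if x i != y i then a else b) =
  a ^+ hamming x y * b ^+ (n - hamming x y).
Proof.
rewrite (bigID (fun i => x i != y i)) /=; congr (_ * _).
  rewrite (eq_bigr (fun=> a)) => [|i ->//].
  by rewrite prodr_const /hamming cardsE.
rewrite (eq_bigr (fun=> b)) => [|i /negbTE ->//].
have nE := cardC (fun i => x i != y i); rewrite card_ord in nE.
by rewrite prodr_const /hamming cardsE -[X in (X - _)%N]nE addKn.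
Qed.

Lemma sum_hamming (R : comNzSemiRingType) n (x : cube n) (a b : R) :
  \sum_y a ^+ hamming x y * b ^+ (n - hamming x y) = (a + b) ^+ n.
Proof.
under eq_bigr do rewrite -prod_hamming.
rewrite (sum_cube_prod (fun i c => if x i != c then a else b)).
rewrite (eq_bigr (fun=> a + b)) ?prodr_const ?card_ord// => i _.
by case: (x i) => //=; rewrite addrC.
Qed.

Lemma card_cube n : #|{: cube n}| = (2 ^ n)%N.
Proof. by rewrite card_ffun card_bool card_ord. Qed.

Lemma forall_nat_prod n (P : pred 'I_n) :
  ([forall i, P i] : nat) = (\prod_i (P i : nat))%N.
Proof.
case: forallP => [allP|/forallP]; first by rewrite big1// => i _; rewrite allP.
by rewrite negb_forall => /existsP[i /negbTE Pi]; rewrite (bigD1 i)//= Pi.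
Qed.

Lemma card_between n (x y : cube n) :
  #|[set z | between x y z]| = (2 ^ hamming x y)%N.
Proof.
rewrite -sum1dep_card big_mkcond.
rewrite (eq_bigr (fun z : cube n =>
  \prod_i ((z i == x i) || (z i == y i) : nat))%N); last first.
  by move=> z _; rewrite -forall_nat_prod /between; case: [forall _, _].
rewrite (sum_cube_prod (fun i c => ((c == x i) || (c == y i) : nat))).
apply: etrans (etrans (prod_hamming x y 2%N 1%N) _); last first.
  by rewrite expr1n mulr1 natrXE.
apply: eq_bigr => i _.
by case: (x i); case: (y i).
Qed.

(** In each coordinate, [y] is free where [x] and [z] agree and equals [z]
    elsewhere. *)
Lemma card_between_end n (x z : cube n) :
  #|[set y | between x y z]| = (2 ^ (n - hamming x z))%N.
Proof.
rewrite -sum1dep_card big_mkcond.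
rewrite (eq_bigr (fun y : cube n =>
  \prod_i ((z i == x i) || (z i == y i) : nat))%N); last first.
  by move=> y _; rewrite -forall_nat_prod /between; case: [forall _, _].
rewrite (sum_cube_prod (fun i c => ((z i == x i) || (z i == c) : nat))).
apply: etrans (etrans (prod_hamming x z 1%N 2%N) _); last first.
  by rewrite expr1n mul1r natrXE.
apply: eq_bigr => i _.
by case: (x i); case: (z i).
Qed.

Lemma expR_ln2 (R : realType) (d : nat) : 2 ^+ d = expR (ln 2 * d%:R) :> R.
Proof. by rewrite expRM_natr lnK// posrE. Qed.

Lemma ln2_bounds (R : realType) : 2^-1 <= ln (2 : R) <= 1.
Proof.
have l2 : expR (ln 2) = 2 :> R by rewrite lnK// posrE.
apply/andP; split.
  rewrite -ler_expR l2; have := @expR_half_le R 1.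
  by rewrite mul1r lexx ler01; lra.
by have := expR_ge1Dx (ln 2 : R); rewrite l2; lra.
Qed.

Lemma expR_le_1Dx (R : realType) (u : R) : -1 < u -> expR (u / (1 + u)) <= 1 + u.
Proof.
move=> u1; have up : 0 < 1 + u by lra.
rewrite -[leRHS]invrK -[leLHS]invrK lef_pV2 ?posrE ?invr_gt0 ?expR_gt0//.
rewrite -expRN; apply: le_trans (expR_ge1Dx _).
by rewrite le_eqVlt; apply/orP; left; apply/eqP; field; lra.
Qed.

Definition far (R : realType) (delta : R) n (x y : cube n) : bool :=
  (2^-1 + delta) * n%:R <= (hamming x y)%:R.

(** Chernoff bound for the distance to [x] of a uniform point: a point is
    weighted by [(1 + delta) ^+ d * (1 - delta) ^+ (n - d)], where [d] is its
    distance to [x]; the weights add up to [2 ^+ n]. *)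
Lemma card_far (R : realType) (delta : R) n (x : cube n) :
  0 <= delta <= 4^-1 ->
  #|[set y | far delta x y]|%:R <= 2 ^+ n * expR (- (delta ^+ 2 * n%:R)).
Proof.
move=> /andP[d0 d1]; rewrite expRN ler_pdivlMr ?expR_gt0//.
have -> : (2 : R) = (1 + delta) + (1 - delta) by ring.
rewrite -(sum_hamming x) -sum1_card natr_sum mulr_suml [leLHS]big_mkcond /=.
apply: ler_sum => y _.
have ha : expR (delta / (1 + delta)) <= 1 + delta by apply: expR_le_1Dx; lra.
have hb : expR (- delta / (1 - delta)) <= 1 - delta by apply: expR_le_1Dx; lra.
case: ifP; last by move=> _; rewrite mulr_ge0// exprn_ge0//; lra.
rewrite inE /far mul1r => fxy.
apply: (@le_trans _ _ (expR (delta / (1 + delta)) ^+ hamming x y *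
                       expR (- delta / (1 - delta)) ^+ (n - hamming x y))).
  rewrite -!expRM_natr -expRD ler_expR natrB ?hamming_le//.
  move: fxy; set d := (hamming x y)%:R; set m := n%:R => fxy.
  have m0 : 0 <= m :> R by rewrite ler0n.
  have A0 : 0 < 1 + delta by lra.
  have B0 : 0 < 1 - delta by lra.
  have -> : delta / (1 + delta) * d + - delta / (1 - delta) * (m - d) =
     delta * (2 * d - (1 + delta) * m) / ((1 + delta) * (1 - delta)).
    by field; rewrite !gt_eqF.
  rewrite ler_pdivlMr ?mulr_gt0//.
  have h : 0 <= delta * (2 * d - (1 + 2 * delta) * m).
    by rewrite mulr_ge0//; nra.
  have h2 : 0 <= delta ^+ 2 * m * delta ^+ 2 by rewrite !mulr_ge0 ?sqr_ge0.
  nra.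
by apply: ler_pM; rewrite ?exprn_ge0 ?expR_ge0// lerXn2r ?nnegrE ?expR_ge0//; lra.
Qed.

(** The parameter of the exponential moment is [2 / eps], for which
    [expR (- (2 / eps)) <= eps / 2]. *)
Lemma card_close (R : realType) (eps : R) n (x : cube n) :
  0 < eps ->
  #|[set z | (hamming x z)%:R <= eps ^+ 2 / 4 * n%:R]|%:R <=
  expR (eps * n%:R) :> R.
Proof.
move=> e0; set s := 2 / eps; have s0 : 0 < s by rewrite divr_gt0.
have es : expR (- s) <= eps / 2.
  rewrite expRN -[leRHS]invf_div lef_pV2 ?posrE ?expR_gt0//.
  by apply: le_trans (expR_ge1Dx _); rewrite -/s lerDr.
have -> : eps * n%:R = eps / 2 * n%:R + s * (eps ^+ 2 / 4 * n%:R).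
  by rewrite /s; field; rewrite gt_eqF.
rewrite expRD -ler_pdivrMr ?expR_gt0// -expRN.
apply: (@le_trans _ _ ((expR (- s) + 1) ^+ n)); last first.
  rewrite expRM_natr lerXn2r ?nnegrE ?addr_ge0 ?expR_ge0//.
  by apply: le_trans (expR_ge1Dx _); lra.
rewrite -(sum_hamming x) -sum1_card natr_sum mulr_suml [leLHS]big_mkcond /=.
apply: ler_sum => y _; rewrite expr1n mulr1 -expRM_natr.
case: ifP; rewrite inE ?expR_ge0// => cl.
by rewrite mul1r ler_expR mulNr lerN2 ler_wpM2l// ltW.
Qed.

Lemma sum_pow2_near (R : realType) (delta : R) n (x : cube n) :
  \sum_(y | ~~ far delta x y) 2 ^+ hamming x y <=
  2 ^+ n * expR (ln 2 * (2^-1 + delta) * n%:R).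
Proof.
apply: (@le_trans _ _ (\sum_(y : cube n) expR (ln 2 * (2^-1 + delta) * n%:R))).
  rewrite big_mkcond /=; apply: ler_sum => y _; case: ifP; rewrite ?expR_ge0//.
  rewrite /far -ltNge => /ltW h; rewrite expR_ln2 ler_expR -mulrA ler_wpM2l//.
  by have /andP[] := ln2_bounds R; lra.
by rewrite sumr_const card_cube -[leLHS]mulr_natl natrX.
Qed.

(** For [z != x], the near points whose edge to [x] can be obstructed by [z]
    (and [z] itself when it is near). *)
Definition shadow (R : realType) (delta : R) n (x z : cube n) : {set cube n} :=
  [set y | ~~ far delta x y && between x y z].

Lemma card_shadow_le (R : realType) (delta : R) n (x z : cube n) :
  #|shadow delta x z|%:R <= 2 ^+ n * expR (- (ln 2 * (hamming x z)%:R)) :> R.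
Proof.
rewrite expRN -expR_ln2 -expfB_cond ?pnatr_eq0 ?hamming_le//.
rewrite -natrX -card_between_end ler_nat subset_leq_card//.
by apply/fintype.subsetP => y; rewrite !inE => /andP[].
Qed.

(** Double counting: a near point [y] lies in the shadows of the
    [2 ^ hamming x y] points of its face through [x]. *)
Lemma sum_shadow_le (R : realType) (delta : R) n (x : cube n) :
  \sum_z #|shadow delta x z|%:R <=
  2 ^+ n * expR (ln 2 * (2^-1 + delta) * n%:R) :> R.
Proof.
apply: le_trans (sum_pow2_near delta x).
have -> : \sum_z #|shadow delta x z|%:R =
    \sum_z \sum_(y | ~~ far delta x y) (between x y z)%:R :> R.
  apply: eq_bigr => z _; rewrite -natr_sum; congr _%:R.
  rewrite -sum1_card [RHS](eq_bigr (fun y => if between x y z then 1 else 0)%N).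
    by rewrite -big_mkcondr /=; apply: eq_bigl => y; rewrite inE.
  by move=> y _; case: between.
rewrite exchange_big /=; apply: ler_sum => y _.
rewrite -natr_sum -natrX ler_nat -card_between -sum1_card big_mkcond /=.
rewrite [leqRHS]big_mkcond /=; apply: leq_sum => z _.
by rewrite inE; case: between.
Qed.

(** * Near-completeness of the graph *)

Definition blocked (R : realType) (delta : R) n (Q : {set cube n})
    (x y : cube n) : bool :=
  ~~ far delta x y && [exists z in Q, [&& z != x, z != y & between x y z]].

Lemma skeleton_adj_near (R : realType) (delta : R) n (Q : {set cube n}) x y :
  delta <= 2^-1 -> x \in Q -> y \in Q -> y != x ->
  ~~ far delta x y -> ~~ blocked delta Q x y -> skeleton_adj R Q x y.
Proof.
move=> d2 xQ yQ yx nf; rewrite /blocked nf /= => /existsPn nb.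
apply: skeleton_adj_of_between => //; first by rewrite eq_sym.
  rewrite ltnNge; apply: contra nf => nh; rewrite /far.
  apply: le_trans (_ : n%:R <= _); last by rewrite ler_nat.
  by have : 0 <= n%:R :> R by []; nra.
move=> z zQ bz; have := nb z; rewrite zQ bz /= andbT negb_and !negbK.
by case/orP => /eqP ->; [left|right].
Qed.

(** Non-adjacency is replaced by its two combinatorial causes, for which
    probabilities can be computed. *)
Definition few_nonneighbours (R : realType) (delta : R) n (Q : {set cube n}) :
    Prop :=
  forall x, x \in Q ->
    (8 * #|[set y in Q | (y != x) && (far delta x y || blocked delta Q x y)]|
     <= #|Q|)%N.

Lemma expansion_of_few_nonneighbours (R : realType) (delta : R) n
    (Q : {set cube n}) :
  delta <= 2^-1 -> few_nonneighbours delta Q ->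
  ((4^-1 * #|Q|%:R)%:E <= edge_expansion R Q (skeleton_adj R Q))%E.
Proof.
move=> d2 few; apply: edge_expansion_ge => x xQ.
apply: leq_trans (few x xQ); rewrite leq_mul2l subset_leq_card ?orbT//.
apply/fintype.subsetP => y; rewrite !inE => /and3P[yQ yx nadj].
rewrite yQ yx /=; apply: contraNT nadj; rewrite negb_or => /andP[nf nb].
exact: skeleton_adj_near nf nb.
Qed.

(** * The sparse regime *)

(** When the expected number [2 ^+ n * p] of points is small, a first moment
    bound over pairs and triples shows that there is no obstruction at all. *)
Lemma sparse_prob (R : realType) (delta p : R) n :
  0 <= p <= 1 -> 0 <= delta <= 4^-1 ->
  random_subset_prob p (fun Q : {set cube n} => ~ few_nonneighbours delta Q) <=
  (2 ^+ n * p) ^+ 2 * (expR (- (delta ^+ 2 * n%:R)) +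
    p * expR (ln 2 * (2^-1 + delta) * n%:R)).
Proof.
move=> p01 d01; have /andP[p0 p1] := p01.
pose pairP (u : cube n * cube n) := (u.2 != u.1) && far delta u.1 u.2.
pose tripleP (u : cube n * cube n * cube n) :=
  [&& u.1.2 != u.1.1, u.2 != u.1.1, u.2 != u.1.2 &
      u.1.2 \in shadow delta u.1.1 u.2].
apply: le_trans (random_subset_prob_mono (B := fun Q =>
  (exists2 u, pairP u & [set u.1; u.2] \subset Q) \/
  (exists2 u, tripleP u & [set u.1.1; u.1.2; u.2] \subset Q)) p01 _) _.
  move=> Q; apply: contra_notP => /not_orP[nopair notriple] x xQ.
  rewrite [X in (8 * X)%N](_ : _ = 0%N) ?muln0//; apply/eqP; rewrite cards_eq0.
  apply/eqP/finset.setP => y; rewrite !inE; apply/negP.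
  case/and3P => yQ yx /orP[fxy|/andP[nf /existsP[z /and4P[zQ zx zy bz]]]].
    apply: nopair; exists (x, y); first by rewrite /pairP /= yx fxy.
    by apply/fintype.subsetP => w /finset.set2P[->|->].
  apply: notriple; exists (x, y, z).
    by rewrite /tripleP /= yx zx zy inE nf bz.
  by apply/fintype.subsetP => w; rewrite !inE => /orP[/orP[]|] /eqP ->.
apply: le_trans (random_subset_prob_or _ _ p01) _; rewrite mulrDr; apply: lerD.
  apply: le_trans (random_subset_prob_ex _ _ p01) _.
  apply: (@le_trans _ _ (\sum_(u | pairP u) p ^+ 2)).
    apply: ler_sum => u /andP[yx _]; rewrite random_subset_prob_sub.
    by rewrite cards2 eq_sym yx.
  apply: (@le_trans _ _ (\sum_x \sum_(y | far delta x y) p ^+ 2)).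
    rewrite pair_big_dep /= big_mkcond [leRHS]big_mkcond; apply: ler_sum => u _.
    rewrite /pairP; case: far; rewrite ?andbF ?andbT//=.
    by case: ifP; rewrite ?exprn_ge0.
  apply: (@le_trans _ _
      (\sum_(x : cube n) 2 ^+ n * expR (- (delta ^+ 2 * n%:R)) * p ^+ 2)).
    apply: ler_sum => x _; rewrite sumr_const -[leLHS]mulr_natl.
    rewrite ler_wpM2r ?exprn_ge0//; have := card_far x d01.
    by rewrite cardsE.
  rewrite sumr_const card_cube -[leLHS]mulr_natl natrX le_eqVlt; apply/orP; left.
  by apply/eqP; ring.
apply: le_trans (random_subset_prob_ex _ _ p01) _.
apply: (@le_trans _ _ (\sum_(u | tripleP u) p ^+ 3)).
  apply: ler_sum => u /and4P[yx zx zy _]; rewrite random_subset_prob_sub.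
  rewrite finset.setUC cardsU1 !inE cards2 negb_or zx zy eq_sym yx.
  by rewrite /= addnC.
apply: (@le_trans _ _ (\sum_(x : cube n) \sum_(z : cube n)
    \sum_(y in shadow delta x z) p ^+ 3)).
  rewrite pair_bigA /= pair_big_dep /= big_mkcond [leRHS]big_mkcond /=.
  (* The sum over [y] becomes the inner one, to count points of shadows. *)
  pose h (u : cube n * cube n * cube n) := (u.1.1, u.2, u.1.2).
  have hK : involutive h by case=> -[].
  rewrite (reindex_inj (inv_inj hK)) /=; apply: ler_sum => -[[x z] y] _.
  rewrite /tripleP /h /=; case: (y \in _); rewrite ?andbF ?andbT//.
  by case: ifP; rewrite ?exprn_ge0.
apply: (@le_trans _ _ (\sum_(x : cube n)
    2 ^+ n * expR (ln 2 * (2^-1 + delta) * n%:R) * p ^+ 3)).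
  apply: ler_sum => x _.
  under eq_bigr do rewrite sumr_const -[_ *+ _]mulr_natl.
  rewrite -mulr_suml ler_wpM2r ?exprn_ge0//.
  exact: sum_shadow_le.
rewrite sumr_const card_cube -[leLHS]mulr_natl natrX le_eqVlt; apply/orP; left.
by apply/eqP; ring.
Qed.

(** * The dense regime *)

(** Two points that differ in coordinate [i] are separated by the set of points
    that agree with [x] there. A point [z] blocking [y] for [x] agrees with [x]
    in some coordinate where [y] does not, so that [z] and [y] lie on different
    sides of one of these [n] cuts. *)
Definition agree n (x : cube n) (i : 'I_n) : {set cube n} :=
  [set z : cube n | z i == x i].

Lemma blocked_cut (R : realType) (delta : R) n (Q : {set cube n}) x y :
  y \in Q -> blocked delta Q x y ->
  exists i, y \in (Q :\: agree x i) :&: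
                  [set y' | blocked delta (Q :&: agree x i) x y'].
Proof.
move=> yQ /andP[nf /existsP[z /and4P[zQ zx zy bz]]].
have [i ziy] : exists i, (z : cube n) i != y i.
  apply/existsP; rewrite -negb_forall; apply: contra zy => /forallP zE.
  by apply/eqP/ffunP => i; exact/eqP.
have zix : z i == x i by have /forallP/(_ i) := bz; rewrite (negbTE ziy) orbF.
exists i; rewrite !inE yQ /= andbT; apply/andP; split.
  by rewrite -(eqP zix) eq_sym.
rewrite /blocked nf /=; apply/existsP; exists z.
by rewrite !inE zQ zix zx zy bz.
Qed.

Lemma card_blocked_le (R : realType) (delta : R) n (Z : {set cube n}) x :
  (#|[set y | blocked delta Z x y]| <=
   \sum_(z in Z | z != x) #|shadow delta x z|)%N.
Proof.
apply: leq_trans (unstable.card_big_setU _ _ _).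
apply/subset_leq_card/fintype.subsetP => y; rewrite inE.
case/andP=> nf /existsP[z /and4P[zZ zx _ bz]].
by apply/bigcupP; exists z; rewrite ?zZ// inE nf.
Qed.

Lemma dense_few_nonneighbours (R : realType) (delta N : R) n (Q : {set cube n}) :
  (0 < n)%N -> N / 4 < #|Q|%:R ->
  (forall x, #|Q :&: [set y | far delta x y]|%:R < N / 64) ->
  (forall x i, x \in Q ->
    #|(Q :\: agree x i) :&: [set y | blocked delta (Q :&: agree x i) x y]|%:R <
    N / (64 * n%:R)) ->
  few_nonneighbours delta Q.
Proof.
move=> n0 Qbig few_far few_cut x xQ.
set B := [set y in Q | _].
pose C i := (Q :\: agree x i) :&:
  [set y | blocked delta (Q :&: agree x i) x y].
have sub : B \subset (Q :&: [set y | far delta x y]) :|: (\bigcup_i C i)%SET.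
  apply/fintype.subsetP => y; rewrite inE => /and3P[yQ _ /orP[fy|]].
    by rewrite !inE yQ fy.
  case/(blocked_cut yQ) => i yi; rewrite finset.inE; apply/orP; right.
  by apply/bigcupP; exists i.
have cardB : (#|B| <= #|Q :&: [set y | far delta x y]| + \sum_i #|C i|)%N.
  apply: leq_trans (subset_leq_card sub) _.
  apply: leq_trans (leq_card_setU _ _) _; rewrite leq_add2l.
  exact: unstable.card_big_setU.
have sumC : (\sum_i #|C i|)%:R <= N / 64 :> R.
  rewrite natr_sum; apply: (@le_trans _ _ (\sum_(i < n) N / (64 * n%:R))).
    by apply: ler_sum => i _; apply/ltW/few_cut.
  rewrite sumr_const card_ord -[leLHS]mulr_natl le_eqVlt; apply/orP; left.
  by apply/eqP; field; rewrite pnatr_eq0 -lt0n.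
(* [N / 64 + n * (N / (64 * n)) <= (N / 4) / 8]. *)
rewrite -(ler_nat R) natrM; move: cardB; rewrite -(ler_nat R) natrD.
have := few_far x; lra.
Qed.

(** Failure of [few_nonneighbours] forces one of five unlikely events: few
    points in total, many points far from some [x], two points of the random
    set close to each other, a heavy total shadow of the points that are not
    close to [x], or many points blocked across one cut although the shadow is
    light. The last event is the decoupled one. *)
Lemma dense_prob (R : realType) (delta eps eta p : R) n :
  0 <= p <= 1 -> 0 <= delta <= 4^-1 -> 0 < eps -> (0 < n)%N ->
  random_subset_prob p (fun Q : {set cube n} => ~ few_nonneighbours delta Q) <=
  expR (- (p * 2 ^+ n / 4)) +
  (2 ^+ n * expR (p * (2 ^+ n * expR (- (delta ^+ 2 * n%:R))) -
                  p * 2 ^+ n / 64 / 2) +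
  (2 ^+ n * expR (eps * n%:R) * p ^+ 2 +
  (2 ^+ n * expR (p * expR (ln 2 * (2^-1 + delta + eps ^+ 2 / 4) * n%:R) -
                  expR ((ln 2 * (eps ^+ 2 / 4) - eta) * n%:R) / 2) +
   2 ^+ n * n%:R * expR (p * (2 ^+ n * expR (- (eta * n%:R))) -
                         p * 2 ^+ n / (64 * n%:R) / 2)))).
Proof.
move=> p01 d01 e0 n0; have /andP[p0 p1] := p01.
pose N := p * 2 ^+ n; pose u : R := 2 ^+ n * expR (- (eta * n%:R)).
pose close (x z : cube n) := (hamming x z)%:R <= eps ^+ 2 / 4 * n%:R.
pose w x z : R := if close x z then 0 else #|shadow delta x z|%:R.
pose pairP (v : cube n * cube n) := (v.2 != v.1) && close v.1 v.2.
pose E1 (Q : {set cube n}) := #|Q|%:R <= N / 4.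
pose E2 (Q : {set cube n}) := exists2 x : cube n, predT x &
  N / 64 <= #|Q :&: [set y | far delta x y]|%:R.
pose E3 (Q : {set cube n}) := exists2 v, pairP v & [set v.1; v.2] \subset Q.
pose E4 (Q : {set cube n}) := exists2 x : cube n, predT x &
  u <= \sum_(z in Q) w x z.
pose U x i (Q : {set cube n}) := [set y | blocked delta (Q :&: agree x i) x y].
pose E5 (Q : {set cube n}) := exists2 v : cube n * 'I_n, predT v &
  #|U v.1 v.2 Q|%:R <= u /\
  N / (64 * n%:R) <= #|(Q :\: agree v.1 v.2) :&: U v.1 v.2 Q|%:R.
apply: le_trans (random_subset_prob_mono
  (B := fun Q => E1 Q \/ (E2 Q \/ (E3 Q \/ (E4 Q \/ E5 Q)))) p01 _) _.
  move=> Q; apply: contra_notP => /not_orP[/negP nE1] /not_orP[nE2].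
  case/not_orP => nE3 /not_orP[nE4 nE5].
  apply: (@dense_few_nonneighbours _ _ N) => //.
  - by rewrite ltNge.
  - by move=> x; rewrite ltNge; apply/negP => h; apply: nE2; exists x.
  move=> x i xQ; rewrite ltNge; apply/negP => h; apply: nE5; exists (x, i) => //.
  split=> //=; have ltu : \sum_(z in Q) w x z < u.
    by rewrite ltNge; apply/negP => h4; apply: nE4; exists x.
  apply: le_trans (ltW ltu); apply: le_trans (_ :
    (\sum_(z in Q :&: agree x i | z != x) #|shadow delta x z|)%:R <= _).
    by rewrite ler_nat; exact: card_blocked_le.
  rewrite natr_sum big_mkcond [leRHS]big_mkcond; apply: ler_sum => z _.
  rewrite /w !inE; case: (boolP (z \in Q)) => //= zQ.
  case: (boolP (close x z)) => [cz|_]; last by case: ifP.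
  case: ifP => // /andP[_ zx]; exfalso; apply: nE3; exists (x, z).
    by rewrite /pairP zx.
  by apply/fintype.subsetP => y /finset.set2P[->|->].
apply: le_trans (random_subset_prob_or _ _ p01) _; apply: lerD.
  have := @chernoff_card_lower R (cube n) p p01.
  by rewrite card_cube natrX.
apply: le_trans (random_subset_prob_or _ _ p01) _; apply: lerD.
  apply: le_trans (random_subset_prob_ex _ _ p01) _.
  apply: (@le_trans _ _ (\sum_(x : cube n)
    expR (p * (2 ^+ n * expR (- (delta ^+ 2 * n%:R))) - p * 2 ^+ n / 64 / 2))).
    apply: ler_sum => x _; apply: le_trans (chernoff_card_upper _ _ p01) _.
    by rewrite ler_expR lerD2r ler_wpM2l// card_far.
  by rewrite sumr_const card_cube -[leLHS]mulr_natl natrX.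
apply: le_trans (random_subset_prob_or _ _ p01) _; apply: lerD.
  apply: le_trans (random_subset_prob_ex _ _ p01) _.
  apply: (@le_trans _ _ (\sum_(v | pairP v) p ^+ 2)).
    apply: ler_sum => v /andP[yx _]; rewrite random_subset_prob_sub.
    by rewrite cards2 eq_sym yx.
  apply: (@le_trans _ _ (\sum_x \sum_(z | close x z) p ^+ 2)).
    rewrite pair_big_dep /= big_mkcond [leRHS]big_mkcond; apply: ler_sum => v _.
    rewrite /pairP; case: (close _ _); rewrite ?andbF ?andbT//=.
    by case: ifP; rewrite ?exprn_ge0.
  apply: (@le_trans _ _ (\sum_(x : cube n) expR (eps * n%:R) * p ^+ 2)).
    apply: ler_sum => x _; rewrite sumr_const -[leLHS]mulr_natl.
    rewrite ler_wpM2r ?exprn_ge0//; have := card_close x e0.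
    by rewrite cardsE.
  by rewrite sumr_const card_cube -[leLHS]mulr_natl natrX mulrA.
apply: le_trans (random_subset_prob_or _ _ p01) _; apply: lerD.
  apply: le_trans (random_subset_prob_ex _ _ p01) _.
  (* Chernoff for the shadows divided by their largest possible size. *)
  pose M : R := 2 ^+ n * expR (- (ln 2 * (eps ^+ 2 / 4) * n%:R)).
  have M0 : 0 < M by rewrite mulr_gt0 ?exprn_gt0 ?expR_gt0.
  have wM x z : 0 <= w x z / M <= 1.
    rewrite /w; case: ifPn => [_|ncl]; first by rewrite mul0r lexx ler01.
    apply/andP; split; first by rewrite divr_ge0// ltW.
    rewrite ler_pdivrMr// mul1r.
    apply: le_trans (card_shadow_le _ _ _) _.
    rewrite ler_pM2l ?exprn_gt0// ler_expR lerN2 -mulrA ler_wpM2l//.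
      by have /andP[] := ln2_bounds R; lra.
    by rewrite ltW// ltNge.
  apply: (@le_trans _ _ (\sum_(x : cube n)
    expR (p * expR (ln 2 * (2^-1 + delta + eps ^+ 2 / 4) * n%:R) -
          expR ((ln 2 * (eps ^+ 2 / 4) - eta) * n%:R) / 2))); last first.
    by rewrite sumr_const card_cube -[leLHS]mulr_natl natrX.
  apply: ler_sum => x _.
  have -> : expR ((ln 2 * (eps ^+ 2 / 4) - eta) * n%:R) = u / M.
    rewrite /u /M invfM -expRN opprK mulrBl expRD mulrACA divff ?expf_neq0//.
    by rewrite mul1r mulrC.
  apply: le_trans (random_subset_prob_mono
    (B := fun Q => u / M <= \sum_(z in Q) w x z / M) p01 _) _.
    by move=> Q; rewrite -mulr_suml ler_pM2r ?invr_gt0.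
  apply: le_trans (chernoff_upper _ p01 (wM x)) _.
  rewrite ler_expR lerD2r ler_wpM2l// -mulr_suml ler_pdivrMr//.
  rewrite /M mulrCA -expRD.
  have -> : ln 2 * (2^-1 + delta + eps ^+ 2 / 4) * n%:R +
    - (ln 2 * (eps ^+ 2 / 4) * n%:R) = ln 2 * (2^-1 + delta) * n%:R :> R by ring.
  apply: le_trans (sum_shadow_le delta x); apply: ler_sum => z _.
  by rewrite /w; case: ifP.
apply: le_trans (random_subset_prob_ex _ _ p01) _.
apply: (@le_trans _ _ (\sum_(v : cube n * 'I_n)
  expR (p * u - p * 2 ^+ n / (64 * n%:R) / 2))).
  apply: ler_sum => v _.
  exact: (decoupled_chernoff _ _ (agree v.1 v.2)
    (fun Z => [set y | blocked delta Z v.1 y]) p01).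
rewrite sumr_const card_prod card_ord card_cube -[leLHS]mulr_natl.
by rewrite natrM natrX.
Qed.

(** * Choice of the rates and conclusion *)

(** Here [eps ^+ 2 / 64] is a common rate for all the exponential savings, and
    the two regimes are separated by whether the expected number of points
    exceeds [expR (eps ^+ 2 / 64 * n%:R)]. *)
Lemma many_nonneighbours_prob (R : realType) (eps p : R) n :
  0 < eps <= 1 -> 0 <= p <= 1 -> (0 < n)%N ->
  p <= expR (- ((ln 2 / 2 + eps) * n%:R)) ->
  1024 * n%:R ^+ 2 <= expR (eps ^+ 2 / 64 * n%:R) ->
  random_subset_prob p
    (fun Q : {set cube n} => ~ few_nonneighbours (eps / 4) Q) <= 5 / n%:R.
Proof.
move=> /andP[e0 e1] p01 n0 p_le; have /andP[p0 _] := p01.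
have /andP[l1 l2] := ln2_bounds R; set l := ln 2 in p_le l1 l2.
have d01 : 0 <= eps / 4 <= 4^-1 by apply/andP; split; lra.
have pow2 : 2 ^+ n = expR (l * n%:R) by exact: expR_ln2.
have m1 : 1 <= n%:R :> R by rewrite ler1n.
set rho := eps ^+ 2 / 64; set m := n%:R in p_le pow2 m1 *.
have m0 : 0 < m by lra.
have m_ge0 := ltW m0.
have m_m2 : m <= m ^+ 2 by rewrite expr2 ler_peMr// ltW.
have rho_eps : eps ^+ 2 = 64 * rho by rewrite /rho; field.
have rho_le : 64 * rho <= eps by rewrite -rho_eps expr2 ler_piMr// ltW.
have rho0 : 0 < rho by rewrite /rho divr_gt0 ?exprn_gt0.
have l_rho : 2^-1 * rho <= l * rho by rewrite ler_wpM2r// ltW.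
have l_rho' : l * rho <= rho by rewrite ler_piMl// ltW.
have l_eps : l * eps <= eps by rewrite ler_piMl// ltW.
set X := expR (rho * m) => X_big.
have X0 : 0 < X by exact: expR_gt0.
have X_m : m <= X by clear -X_big m_m2 m0; lra.
have invX : X^-1 <= m^-1 by rewrite lef_pV2 ?posrE.
have mV0 : 0 < m^-1 by rewrite invr_gt0.
have p_expR (a b : R) : a - (l / 2 + eps) <= b ->
    p * expR (a * m) <= expR (b * m).
  move=> ab; apply: le_trans (ler_wpM2r (expR_ge0 _) p_le) _.
  rewrite -expRD ler_expR -mulNr -mulrDl ler_wpM2r//.
  by rewrite [leLHS]addrC.
have [N_le|N_gt] := leP (2 ^+ n * p) X.
  apply: le_trans (sparse_prob n p01 d01) _.
  have far_le : expR (- ((eps / 4) ^+ 2 * m)) <= expR (- (4 * rho) * m).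
    by rewrite ler_expR -mulNr ler_wpM2r// /rho; clear; lra.
  have shadow_le : p * expR (l * (2^-1 + eps / 4) * m) <= expR (- (4 * rho) * m).
    by apply: p_expR; clear -l_eps rho_le rho0; lra.
  have XX : X ^+ 2 * expR (- (4 * rho) * m) <= X^-1.
    rewrite /X -expRM_natr -expRD -expRN ler_expR.
    have : 0 <= rho * m by rewrite mulr_ge0 ?ltW.
    by clear; lra.
  apply: (@le_trans _ _ (X ^+ 2 *
      (expR (- (4 * rho) * m) + expR (- (4 * rho) * m)))).
    apply: ler_pM; rewrite ?sqr_ge0 ?addr_ge0 ?mulr_ge0 ?expR_ge0//.
      by rewrite lerXn2r ?nnegrE ?mulr_ge0 ?exprn_ge0// ltW.
    exact: lerD.
  by rewrite mulrDr; clear -XX invX mV0; lra.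
rewrite mulrC in N_gt.
apply: le_trans (@dense_prob _ (eps / 4) eps rho _ _ p01 d01 e0 n0) _.
rewrite -/l -/m; set N := p * 2 ^+ n in N_gt *.
have em : expR (- m) <= m^-1.
  rewrite expRN lef_pV2 ?posrE ?expR_gt0//.
  by apply: le_trans (expR_ge1Dx _); rewrite lerDr.
have m_expR : m <= expR m by apply: le_trans (expR_ge1Dx _); rewrite lerDr.
have pow2m : 2 ^+ n <= expR m by rewrite pow2 ler_expR ler_piMl// ltW.
have N_big : 1024 * m ^+ 2 <= N by exact: le_trans (ltW N_gt).
have N0 : 0 <= N by clear -N_big m_m2 m0; lra.
have Y_m : expR (- (rho * m)) <= m^-1 / 1024.
  rewrite expRN -/X -[leLHS]mul1r ler_pdivrMr//.
  have X_m' : 1024 * m <= X by clear -X_big m_m2; lra.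
  have := ler_wpM2l (ltW mV0) X_m'; have := mulVf (lt0r_neq0 m0).
  by clear; lra.
have m_V : m^-1 <= 1 by rewrite invf_le1.
(* An exponent [- 2 * n] pays for the union bound over the centres. *)
have saved (a : R) : a <= - (2 * m) -> 2 ^+ n * expR a <= m^-1.
  move=> am; apply: le_trans em; apply: le_trans (ler_wpM2r (expR_ge0 _) pow2m) _.
  by rewrite -expRD ler_expR; clear -am; lra.
have T1 : expR (- (N / 4)) <= m^-1.
  by apply: le_trans em; rewrite ler_expR; clear -N_big m_m2 m0; lra.
have T2 : 2 ^+ n * expR (p * (2 ^+ n * expR (- ((eps / 4) ^+ 2 * m))) -
    N / 64 / 2) <= m^-1.
  apply: saved; rewrite mulrA -/N.
  have Y_le : expR (- ((eps / 4) ^+ 2 * m)) <= 1024^-1.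
    apply: le_trans (_ : expR (- (rho * m)) <= _).
      rewrite ler_expR lerN2 ler_wpM2r//.
      by clear -rho_eps rho0; lra.
    by apply: le_trans Y_m _; clear -m_V; lra.
  have := ler_wpM2l N0 Y_le; clear -N_big m_m2 m0; lra.
have T3 : 2 ^+ n * expR (eps * m) * p ^+ 2 <= m^-1.
  apply: le_trans invX; rewrite pow2 -expRD.
  apply: (@le_trans _ _ (expR (l * m + eps * m) *
      expR (- ((l / 2 + eps) * m)) ^+ 2)).
    by rewrite ler_wpM2l ?expR_ge0// lerXn2r ?nnegrE ?expR_ge0.
  rewrite -expRM_natr -expRD /X -expRN ler_expR.
  have : rho * m <= eps * m.
    by rewrite ler_wpM2r//; clear -rho_le rho0; lra.
  by clear; lra.
have T4 : 2 ^+ n * expR (p * expR (l * (2^-1 + eps / 4 + eps ^+ 2 / 4) * m) -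
    expR ((l * (eps ^+ 2 / 4) - rho) * m) / 2) <= m^-1.
  apply: saved; rewrite rho_eps.
  have h1 : p * expR (l * (2^-1 + eps / 4 + 64 * rho / 4) * m) <= 1.
    have := p_expR (l * (2^-1 + eps / 4 + 64 * rho / 4)) 0.
    by rewrite mul0r expR0; apply; clear -l_rho' l_eps rho_le e0; lra.
  have h2 : X <= expR ((l * (64 * rho / 4) - rho) * m).
    rewrite ler_expR ler_wpM2r//.
    by clear -l_rho rho0; lra.
  by clear -h1 h2 X_big m_m2 m1; lra.
have T5 : 2 ^+ n * m * expR (p * (2 ^+ n * expR (- (rho * m))) -
    N / (64 * m) / 2) <= m^-1.
  apply: le_trans (_ : 2 ^+ n * (expR m * expR (- (3 * m))) <= _); last first.
    by rewrite -expRD; apply: saved; clear; lra.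
  rewrite -mulrA ler_wpM2l// ler_pM ?expR_ge0// ler_expR.
  rewrite mulrA -/N.
  have -> : N / (64 * m) / 2 = N * (m^-1 / 128) by field; rewrite gt_eqF.
  have h1 := ler_wpM2l N0 Y_m.
  have h2 : 1024 * m ^+ 2 * m^-1 <= N * m^-1 by rewrite ler_wpM2r// ltW.
  have h3 : 1024 * m ^+ 2 * m^-1 = 1024 * m by field; rewrite gt_eqF.
  by clear -h1 h2 h3 m0; lra.
by clear -T1 T2 T3 T4 T5; lra.
Qed.

Lemma sqr_le_expR_near (R : realType) (rho : R) : 0 < rho ->
  \forall n \near \oo%classic, 1024 * n%:R ^+ 2 <= expR (rho * n%:R) :> R.
Proof.
move=> rho0; near=> n.
have n_big : 6144 / rho ^+ 3 <= n%:R by near: n; exact: nbhs_infty_ger.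
apply: le_trans (_ : 1 + (rho * n%:R) ^+ 3 / 3`!%:R <= _); last first.
  by apply: expR_ge1Dxn; rewrite mulr_ge0// ltW.
move: n_big; rewrite ler_pdivrMr ?exprn_gt0// => n_big.
have -> : (rho * n%:R) ^+ 3 / 3`!%:R = n%:R * rho ^+ 3 * n%:R ^+ 2 / 6.
  by rewrite (_ : 3`!%:R = 6)//; field.
have := ler_wpM2r (sqr_ge0 (n%:R : R)) n_big; lra.
Unshelve. all: by end_near. Qed.

Lemma pow_le_expR (R : realType) (eps : R) n : eps <= 1 ->
  ((1 - eps) / Num.sqrt 2) ^+ n <= expR (- ((ln 2 / 2 + eps) * n%:R)).
Proof.
move=> e1; rewrite -mulNr expRM_natr.
have sqrt2 : Num.sqrt 2 = expR (ln 2 / 2) :> R.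
  rewrite -[RHS]ger0_norm ?expR_ge0// -sqrtr_sqr -expRM_natr; congr Num.sqrt.
  by rewrite divfK// lnK ?posrE.
rewrite sqrt2 -expRN lerXn2r ?nnegrE ?expR_ge0 ?mulr_ge0 ?expR_ge0 ?subr_ge0//.
by rewrite opprD expRD mulrC ler_wpM2l ?expR_ge0 ?expR_ge1Dx.
Qed.

Local Open Scope classical_set_scope.

Theorem corollary1p5 (R : realType) (eps : R) (p : nat -> R)
    (eps_gt0 : 0 < eps)
    (p01 : forall n : nat, (1 <= n)%N -> 0 <= p n <= 1)
    (p_le : forall n : nat, (1 <= n)%N ->
       p n <= ((1 - eps) / Num.sqrt 2) ^+ n) :
  exists2 c : R, 0 < c &
    (fun n : nat =>
       random_subset_prob (p n) (fun Q : {set cube n} =>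
         ((c * #|Q|%:R)%:E <= edge_expansion R Q (skeleton_adj R Q))%E))
      @ \oo --> (1 : R).
Proof.
(* Otherwise the bound on [p 1] would be negative. *)
have eps_le1 : eps <= 1.
  have /andP[p1 _] := p01 1%N isT; have := le_trans p1 (p_le 1%N isT).
  by rewrite expr1 pmulr_lge0 ?invr_gt0 ?sqrtr_gt0// subr_ge0.
exists 4^-1 => //; apply/cvgrPdist_le => /= r r0.
have rho0 : 0 < eps ^+ 2 / 64 by rewrite divr_gt0 ?exprn_gt0.
have eps4 : eps / 4 <= 2^-1 by lra.
near=> n.
have n0 : (0 < n)%N by near: n; exact: nbhs_infty_gt.
rewrite ger0_norm ?subr_ge0 ?random_subset_prob_le1 ?p01//.
rewrite lerBlDl -lerBlDr; apply: le_trans (_ : _ <= 1 - 5 / n%:R) _.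
  rewrite lerD2l lerN2 ler_pdivrMr ?ltr0n// mulrC -ler_pdivrMr//.
  by near: n; exact: nbhs_infty_ger.
apply: le_trans (random_subset_prob_mono (p01 n n0) (fun Q few =>
  @expansion_of_few_nonneighbours R (eps / 4) n Q eps4 few)).
rewrite random_subset_prob_not lerD2l lerN2.
apply: many_nonneighbours_prob; rewrite ?eps_gt0 ?p01//.
  exact: le_trans (p_le n n0) (pow_le_expR n eps_le1).
by near: n; exact: sqr_le_expR_near.
Unshelve. all: by end_near. Qed.
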